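(* Let $Q$ be a sub-basilica stable property of generalized basilica groups and suppose that $P$ is a property of groups enjoyed by abelian groups and stable under taking subgroups, finite direct products, and $P$-by-finite groups. If every self-replicating generalized basilica group with property $Q$ has property $P$, then every generalized basilica group with property $Q$ is (locally finite)-by-$P$.
   Context: Let $X$ be a finite set, let $X^*$ be the free monoid on $X$, viewed as a rooted tree, and let $\mathrm{Aut}(X^* )$ be the group of bijections $g$ of $X^*$ such that $a$ is a prefix of $b$ if and only if $g(a)$ is a prefix of $g(b)$. For $g\in\mathrm{Aut}(X^* )$ and $w\in X^*$, the section $g_w\in \mathrm{Aut}(X^* )$ is the automorphism determined by $g(wu)=g(w)g_w(u)$ for all $u\in X^*$. A group $G\le \mathrm{Aut}(X^* )$ is self-similar if $g_w\in G$ for all $g\in G$, $w\in X^*$, and self-replicating if it is self-similar, acts transitively on $X$, and $\{g_x\mid g\in G,\ g(x)=x\}=G$ for all $x\in X$. $G\le\mathrm{Aut}(X^* )$ is a generalized basilica group if it admits a finite generating set $Y$ (a distinguished generating set) such that for every $g\in Y$ either $g_x=1$ for all $x\in X$, or $g_x\in\{1,g\}$ for all $x\in X$ with exactly one $x\in X$ such that $g_x=g$. Writing $G=\langle Y\rangle\le\mathrm{Aut}(X^* )$ indicates that $Y$ is a distinguished generating set. A property of generalized basilica groups is a property of such data $G=\langle Y\rangle\le\mathrm{Aut}(X^* )$ (it may depend on $X$ and $Y$); a property of groups is isomorphism invariant. If $G=\langle Y\rangle\le\mathrm{Aut}(X^* )$ is a generalized basilica group and $O\subseteq X$ is setwise preserved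 by $G$, then $O^*$ is setwise preserved by $G$, and the image $\phi(G)$ of the induced homomorphism $\phi:G\to\mathrm{Aut}(O^* )$ (restriction) is a generalized basilica group with distinguished generating set $\phi(Y)$. The action of $G$ on $O^*$ is called a sub-basilica action, and $\phi(G)$ the generalized basilica group induced by it. A property $Q$ of generalized basilica groups is sub-basilica stable if for every generalized basilica group $G=\langle Y\rangle\le\mathrm{Aut}(X^* )$ with property $Q$ and every generalized basilica group of the form $\langle Y'\rangle\le\mathrm{Aut}(X^* )$ with $Y'\subseteq Y$, any generalized basilica group induced by a sub-basilica action of $\langle Y'\rangle$ has property $Q$; in particular (taking $O=X$), $\langle Y'\rangle$ has $Q$. A group is $A$-by-$B$ if it has a normal subgroup with property $A$ whose quotient has property $B$; stability of $P$ under $P$-by-finite groups means that every $P$-by-finite group has $P$. *)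

(* Defs.v *)
From HB Require Import structures.
#[warnings="-notation-overridden"]
From mathcomp Require Import all_boot.
From mathcomp Require Import boolp classical_sets functions cardinality.

Set Implicit Arguments.
Unset Strict Implicit.
Unset Printing Implicit Defensive.

Local Open Scope group_scope.
Local Open Scope classical_set_scope.

(* Subgroups of a (possibly infinite) [groupType] are the [groupClosed]
   predicates of the library. *)

Section Subgroups.
Variable G : groupType.

Definition subgrp (H : groupClosed G) : Type := {x : G | x \in H}.

Fact subgrp_closed (H : groupClosed G) : group_closed H.
Proof. by split=> [|x y xH yH]; [apply: gpred1 | apply: gpredF]. Qed.

HB.instance Definition _ (H : groupClosed G) := SubChoice.on (subgrp H).
HB.instance Definition _ (H : groupClosed G) :=
  SubChoice_isSubGroup.Build G _ (subgrp H) (subgrp_closed H).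

Definition gen (Y : set G) : {pred G} :=
  fun x => `[< forall H : groupClosed G, {in Y, forall y, y \in H} -> x \in H >].

Lemma gen_mul (Y : set G) : mulg_closed (gen Y).
Proof.
move=> x y /asboolP hx /asboolP hy; apply/asboolP => H hH.
by apply: gpredM; [apply: hx | apply: hy].
Qed.

Lemma gen_one (Y : set G) : 1 \in gen Y.
Proof. by apply/asboolP => H _; apply: gpred1. Qed.

Lemma gen_inv (Y : set G) : invg_closed (gen Y).
Proof. by move=> x /asboolP hx; apply/asboolP => H hH; rewrite gpredV hx. Qed.

HB.instance Definition _ (Y : set G) := isMulClosed.Build G (gen Y) (@gen_mul Y).
HB.instance Definition _ (Y : set G) := isMul1Closed.Build G (gen Y) (gen_one Y).
HB.instance Definition _ (Y : set G) := isInvClosed.Build G (gen Y) (@gen_inv Y).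

Lemma sub_gen (Y : set G) : {in Y, forall y, y \in gen Y}.
Proof. by move=> y hy; apply/asboolP => H; apply. Qed.

Definition normal_subgrp (N : groupClosed G) : Prop :=
  forall x y : G, x \in N -> x ^ y \in N.

End Subgroups.
Arguments gen {G} Y.

Section Quotient.
Variables (G : groupType) (N : groupClosed G).

Definition coset_rel : rel G := fun x y => x^-1 * y \in N.

Lemma coset_rel_equiv : equiv_class_of coset_rel.
Proof.
split; rewrite /coset_rel.
- by move=> x; rewrite mulVg gpred1.
- by move=> x y; rewrite -(gpredV N (x^-1 * y)) invgM invgK.
- move=> y x z hxy hyz.
  have -> : x^-1 * z = (x^-1 * y) * (y^-1 * z) by rewrite mulgA mulgK.
  exact: gpredM.
Qed.

Canonical coset_equiv := EquivRelPack coset_rel_equiv.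

Definition quot (nN : normal_subgrp N) : Type := {eq_quot coset_equiv}%qT.

Variable nN : normal_subgrp N.
HB.instance Definition _ := Choice.on (quot nN).

Definition coset_of (x : G) : quot nN := (\pi_({eq_quot coset_equiv}) x)%qT.
Definition quot_mul (a b : quot nN) : quot nN := coset_of (repr a * repr b).
Definition quot_one : quot nN := coset_of 1.
Definition quot_inv (a : quot nN) : quot nN := coset_of (repr a)^-1.

Lemma coset_of_eqP (x y : G) : coset_of x = coset_of y <-> x^-1 * y \in N.
Proof.
by rewrite /coset_of; split=> [/eqP|h]; [|apply/eqP]; rewrite eqmodE.
Qed.

Lemma coset_of_repr (a : quot nN) : coset_of (repr a) = a.
Proof. exact: reprK. Qed.

Lemma coset_ofM (x y : G) : quot_mul (coset_of x) (coset_of y) = coset_of (x * y).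
Proof.
have /coset_of_eqP hx := coset_of_repr (coset_of x).
have /coset_of_eqP hy := coset_of_repr (coset_of y).
apply/coset_of_eqP; set u := repr _ in hx *; set v := repr _ in hy *.
have -> : (u * v)^-1 * (x * y) = ((u^-1 * x) ^ v) * (v^-1 * y).
  by rewrite invgM /conjg !mulgA mulgK.
by apply: gpredM => //; apply: nN.
Qed.

Lemma coset_ofV (x : G) : quot_inv (coset_of x) = coset_of x^-1.
Proof.
have /coset_of_eqP hx := coset_of_repr (coset_of x).
apply/coset_of_eqP; set u := repr _ in hx *.
have -> : u^-1^-1 * x^-1 = ((u^-1 * x)^-1) ^ u^-1.
  by rewrite invgM invgK /conjg invgK !mulgA mulgK.
by apply: nN; rewrite gpredV.
Qed.

Fact quot_mulA : associative quot_mul.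
Proof.
move=> a b c; rewrite -(coset_of_repr a) -(coset_of_repr b) -(coset_of_repr c).
by rewrite !coset_ofM mulgA.
Qed.
Fact quot_mul1 : left_id quot_one quot_mul.
Proof. by move=> a; rewrite -(coset_of_repr a) coset_ofM mul1g. Qed.
Fact quot_mulr1 : right_id quot_one quot_mul.
Proof. by move=> a; rewrite -(coset_of_repr a) coset_ofM mulg1. Qed.
Fact quot_mulV : left_inverse quot_one quot_inv quot_mul.
Proof. by move=> a; rewrite -(coset_of_repr a) coset_ofV coset_ofM mulVg. Qed.
Fact quot_mulrV : right_inverse quot_one quot_inv quot_mul.
Proof. by move=> a; rewrite -(coset_of_repr a) coset_ofV coset_ofM mulgV. Qed.

HB.instance Definition _ := isGroup.Build (quot nN)
  quot_mulA quot_mul1 quot_mulr1 quot_mulV quot_mulrV.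

End Quotient.

Section DirectProduct.
Variables (I : finType) (G : I -> groupType).

Definition dprodg : Type := forall i, G i.
HB.instance Definition _ := Choice.on dprodg.

Definition dprodg_mul (f g : dprodg) : dprodg := fun i => f i * g i.
Definition dprodg_one : dprodg := fun i => 1.
Definition dprodg_inv (f : dprodg) : dprodg := fun i => (f i)^-1.

Fact dprodg_mulA : associative dprodg_mul.
Proof. by move=> f g h; apply: functional_extensionality_dep => i; apply: mulgA. Qed.
Fact dprodg_mul1 : left_id dprodg_one dprodg_mul.
Proof. by move=> f; apply: functional_extensionality_dep => i; apply: mul1g. Qed.
Fact dprodg_mulr1 : right_id dprodg_one dprodg_mul.
Proof. by move=> f; apply: functional_extensionality_dep => i; apply: mulg1. Qed.
Fact dprodg_mulV : left_inverse dprodg_one dprodg_inv dprodg_mul.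
Proof. by move=> f; apply: functional_extensionality_dep => i; apply: mulVg. Qed.
Fact dprodg_mulrV : right_inverse dprodg_one dprodg_inv dprodg_mul.
Proof. by move=> f; apply: functional_extensionality_dep => i; apply: mulgV. Qed.

HB.instance Definition _ := isGroup.Build dprodg
  dprodg_mulA dprodg_mul1 dprodg_mulr1 dprodg_mulV dprodg_mulrV.

End DirectProduct.

Definition isomorphic (G H : groupType) : Prop :=
  exists f : {multiplicative G -> H}, bijective f.

Definition isom_invariant (P : groupType -> Prop) : Prop :=
  forall G H : groupType, isomorphic G H -> P G -> P H.

Definition abelian_group (G : groupType) : Prop := forall x y : G, commute x y.

Definition finite_group (G : groupType) : Prop := finite_set [set: G].

Definition locally_finite (G : groupType) : Prop :=
  forall Y : set G, finite_set Y -> finite_set [set x | x \in gen Y].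

Definition group_by (A B : groupType -> Prop) (G : groupType) : Prop :=
  exists (N : groupClosed G) (nN : normal_subgrp N),
    A (subgrp N) /\ B (quot nN).

Section TreeAutomorphisms.
Variable X : finType.

Record aut : Type := Aut {
  aut_fun :> seq X -> seq X;
  aut_bij : bijective aut_fun;
  aut_prefix : forall a b, prefix a b = prefix (aut_fun a) (aut_fun b)
}.

HB.instance Definition _ := gen_eqMixin aut.
HB.instance Definition _ := gen_choiceMixin aut.

Lemma aut_ext (g h : aut) : g =1 h -> g = h.
Proof.
case: g h => [g gb gp] [h hb hp] /= /funext E; subst h.
by congr Aut; apply: Prop_irrelevance.
Qed.

Definition aut_one : aut.
Proof. by exists id => //; exists id. Defined.

Definition aut_mul (g h : aut) : aut.
Proof.
exists (g \o h); first by apply: bij_comp; apply: aut_bij.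
by move=> a b; rewrite (aut_prefix h) (aut_prefix g).
Defined.

Lemma aut_inv_ex (g : aut) : exists h : aut, cancel g h /\ cancel h g.
Proof.
case: (aut_bij g) => k gk kg.
have kb : bijective k by exists g.
have kp a b : prefix a b = prefix (k a) (k b) by rewrite [RHS](aut_prefix g) !kg.
by exists (Aut kb kp).
Qed.

Definition aut_inv (g : aut) : aut := sval (cid (aut_inv_ex g)).

Lemma aut_invK (g : aut) : cancel g (aut_inv g).
Proof. by rewrite /aut_inv; case: cid => h /= []. Qed.

Lemma aut_invKV (g : aut) : cancel (aut_inv g) g.
Proof. by rewrite /aut_inv; case: cid => h /= []. Qed.

Fact aut_mulA : associative aut_mul.
Proof. by move=> f g h; apply: aut_ext. Qed.
Fact aut_mul1 : left_id aut_one aut_mul.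
Proof. by move=> f; apply: aut_ext. Qed.
Fact aut_mulr1 : right_id aut_one aut_mul.
Proof. by move=> f; apply: aut_ext. Qed.
Fact aut_mulV : left_inverse aut_one aut_inv aut_mul.
Proof. by move=> f; apply: aut_ext => w /=; rewrite aut_invK. Qed.
Fact aut_mulrV : right_inverse aut_one aut_inv aut_mul.
Proof. by move=> f; apply: aut_ext => w /=; rewrite aut_invKV. Qed.

HB.instance Definition _ := isGroup.Build aut
  aut_mulA aut_mul1 aut_mulr1 aut_mulV aut_mulrV.

Definition section_fun (g : aut) (w u : seq X) : seq X :=
  drop (size (g w)) (g (w ++ u)).

Lemma section_funE (g : aut) w u : g (w ++ u) = g w ++ section_fun g w u.
Proof.
have : prefix (g w) (g (w ++ u)) by rewrite -aut_prefix prefix_prefix.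
by rewrite /section_fun => /prefixP[v ->]; rewrite drop_size_cat.
Qed.

Lemma section_bij (g : aut) w : bijective (section_fun g w).
Proof.
exists (section_fun g^-1 (g w)) => u; rewrite {1}/section_fun.
  by rewrite -section_funE !aut_invK drop_size_cat.
have := section_funE g^-1 (g w) u; rewrite aut_invK => <-.
by rewrite aut_invKV drop_size_cat.
Qed.

Lemma section_prefix (g : aut) w a b :
  prefix a b = prefix (section_fun g w a) (section_fun g w b).
Proof.
have := aut_prefix g (w ++ a) (w ++ b); rewrite !section_funE.
by rewrite !prefix_catr // !eqxx.
Qed.

Definition section (g : aut) (w : seq X) : aut :=
  Aut (section_bij g w) (section_prefix g w).

Lemma sectionE (g : aut) w u : g (w ++ u) = g w ++ section g w u.
Proof. exact: section_funE. Qed.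

Lemma section_unique (g h : aut) w :
  (forall u, g (w ++ u) = g w ++ h u) -> h = section g w.
Proof.
move=> gh; apply: aut_ext => u.
by rewrite /section /= /section_fun gh drop_size_cat.
Qed.

Definition letter_transitive (G : {pred aut}) : Prop :=
  forall x y : X, exists2 g, g \in G & g [:: x] = [:: y].

Definition self_similar (G : {pred aut}) : Prop :=
  forall g w, g \in G -> section g w \in G.

Definition self_replicating (G : {pred aut}) : Prop :=
  [/\ self_similar G, letter_transitive G &
      forall x : X,
        [set section g [:: x] | g in [set g | g \in G /\ g [:: x] = [:: x]]]
        = [set g | g \in G]].

(* The group is [gen Y]; the data (X, Y) determine it. *)
Definition gen_basilica (Y : set aut) : Prop :=
  finite_set Y /\
  forall g, Y g ->
    (forall x : X, section g [:: x] = 1) \/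
    ((forall x : X, section g [:: x] = 1 \/ section g [:: x] = g) /\
     exists! x : X, section g [:: x] = g).

Definition preserved (G : {pred aut}) (O : {set X}) : Prop :=
  forall g, g \in G ->
    [set g [:: x] | x in [set x | x \in O]] = [set [:: x] | x in [set x | x \in O]].

End TreeAutomorphisms.
Arguments section {X} g w : simpl never.

Section Restriction.
Variables (X : finType) (O : {set X}).

Definition alphabet : finType := {x : X | x \in O}.

Definition restricts (g : aut X) (h : aut alphabet) : Prop :=
  forall w : seq alphabet, map val (h w) = g (map val w).

(* Restriction to O^*; the value 1 is taken only when g does not stabilise O^*,
   see [restrictE]. *)
Definition restrict (g : aut X) : aut alphabet :=
  xget 1 [set h | restricts g h].

Lemma restricts_restrict (g : aut X) :
  g @` [set w | all (mem O) w] = [set w | all (mem O) w] ->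
  restricts g (restrict g).
Proof.
move=> gO.
suff [h hh] : exists h, restricts g h by rewrite /restrict; case: xgetP => [k ? //|/(_ h)].
pose f (w : seq alphabet) : seq alphabet := pmap insub (g (map val w)).
pose f' (w : seq alphabet) : seq alphabet := pmap insub (g^-1 (map val w)).
have insK (w : seq X) : all (mem O) w -> map val (pmap insub w : seq alphabet) = w.
  by elim: w => //= x w IH /andP[xO /IH wE]; rewrite insubT /= wE.
have valO (w : seq alphabet) : all (mem O) (map val w).
  by elim: w => //= x w ->; rewrite andbT; apply: valP.
have fE w : map val (f w) = g (map val w).
  apply: insK; suff : [set w | all (mem O) w] (g (map val w)) by [].
  by rewrite -gO; exists (map val w) => //; apply: valO.
have f'E w : map val (f' w) = g^-1 (map val w).
  apply: insK; have : [set w | all (mem O) w] (map val w) by apply: valO.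
  by rewrite -gO => -[u uO <-]; rewrite aut_invK.
have vI : injective (map val : seq alphabet -> seq X) by apply/inj_map/val_inj.
have fb : bijective f.
  by exists f' => w; apply: vI; rewrite ?(f'E, fE) ?(f'E, fE) ?aut_invK ?aut_invKV.
have vp (a b : seq alphabet) : prefix (map val a) (map val b) = prefix a b.
  by elim: a b => [|x a IH] [|y b] //=; rewrite IH.
have fp a b : prefix a b = prefix (f a) (f b) by rewrite -[RHS]vp !fE -aut_prefix vp.
by exists (Aut fb fp).
Qed.

Lemma restrictE (Y : set (aut X)) (g : aut X) :
  gen_basilica Y -> preserved (gen Y) O -> Y g -> restricts g (restrict g).
Proof.
move=> [_ hY] hO Yg; apply: restricts_restrict.
have gO : g \in gen Y by apply: sub_gen; rewrite inE.
have {}hO := hO _ gO.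
have sec x : section g [:: x] = 1 \/ section g [:: x] = g.
  by have [h|[h _]] := hY _ Yg; [left|].
have gx x w : g (x :: w) = g [:: x] ++ section g [:: x] w by rewrite -sectionE.
have g0 : g [::] = [::].
  have : prefix (g [::]) (g (g^-1 [::])) by rewrite -aut_prefix prefix0s.
  by rewrite aut_invKV prefixs0 => /eqP.
apply/seteqP; split=> [_ [w wO <-]|w wO] /=.
  elim: w wO => [|x w IH] /=; first by rewrite g0.
  move=> /andP[xO wO]; rewrite gx all_cat.
  have : [set [:: x] | x in [set x | x \in O]] (g [:: x]) by rewrite -hO; exists x.
  case=> y yO <-; case: (sec x) => ->; rewrite /= (yO : y \in O).
    exact: wO.
  exact: IH.
elim: w wO => [|y w IH] /=; first by exists [::].
move=> /andP[yO wO].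
have : [set [:: x] | x in [set x | x \in O]] [:: y] by exists y.
rewrite -hO => -[x xO gxy].
case: (sec x) => sx.
  exists (x :: w); first by rewrite /= (xO : x \in O).
  by rewrite gx sx gxy.
have [u uO guw] := IH wO.
exists (x :: u); first by rewrite /= (xO : x \in O).
by rewrite gx sx gxy guw.
Qed.

End Restriction.

(* A property of the data (X, Y) is only ever evaluated when [gen_basilica Y].
   The clause [Q X Y'] is the case O = X; it is listed because the alphabet
   [alphabet [set: X]] is only in bijection with X. *)
Definition sub_basilica_stable
    (Q : forall X : finType, set (aut X) -> Prop) : Prop :=
  forall (X : finType) (Y : set (aut X)), gen_basilica Y -> Q X Y ->
  forall Y' : set (aut X), Y' `<=` Y -> gen_basilica Y' ->
    Q X Y' /\
    (forall O : {set X}, preserved (gen Y') O ->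
       Q (alphabet O) [set restrict O g | g in Y']).

(* Main.v *)
From HB Require Import structures.
From mathcomp Require Import fingroup perm all_boot.
From mathcomp Require Import boolp classical_sets functions cardinality.
Require Import Defs.

(** Why the theorem is true.  Say that a subgroup is good when it maps to a
    group with P with locally finite kernel ([lf_by]).  Goodness of <Y> is
    proved by induction on the size of the alphabet X, through two reductions
    that lead to the self-replicating case.

    Rooted generators.  Call g in Y directed at the letter a when g_a = g and
    all its other letter sections are trivial; the remaining generators have
    trivial letter sections.  Hence all letter sections of <Y> lie in the group
    H generated by the directed elements of Y, and g |-> ((g_x)_x, action on X)
    embeds <Y> into the wreath product of H with Sym(X).  If H maps to L, then
    <Y> maps to the wreath product of L with Sym(X), which is P-by-finite when
    L has P, and the kernel sits in a finite power of the kernel of H -> L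
    ([lf_by_letter_perm]).  So one may replace Y by its directed elements.

    Transitive case.  A directed generator g with section g at a moves a along
    an edge with label g; but the rest of the g-cycle through a joins the same
    two letters by edges with trivial labels.  So any letter is sent to any
    other by an element with trivial section there, every generator occurs as a section of
    a stabiliser, and the group is self-replicating
    ([directed_self_replicating]); the hypothesis on P and Q applies.

    Intransitive case.  Each orbit O is a smaller alphabet, and the restriction
    to O^* is good by induction.  It remains to see that the joint kernel K of
    these restrictions is locally finite ([lf_orbit_kernel]).  Only generators
    directed at a letter of O survive in the section at a word over O, and
    they lose their section as soon as a letter outside O is read.  So an element
    of K is determined by the permutations of letters performed after words
    with all letters in one orbit, and since K fixes those words, this embeds
    K into a power of Sym(X), possibly infinite.  A power of one finite group F
    is locally finite because n generators take at most |F|^n joint values over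
    all coordinates ([lf_residually_bounded]).  The maps are then composed
    using that locally-finite-by-locally-finite groups are locally finite
    ([lf_extension]). *)

Set Implicit Arguments.
Unset Strict Implicit.
Unset Printing Implicit Defensive.

Local Open Scope group_scope.
Local Open Scope classical_set_scope.

(** * Generated subgroups and morphisms on a subgroup *)

Section RightStabiliser.
Variables (G : groupType) (A : set G).

(** [gen Y] is an intersection of subgroups, so induction on words in Y is
    obtained by exhibiting one subgroup that contains Y: the right stabiliser of
    the set of values reached so far. *)
Definition rstab : {pred G} :=
  fun g => `[< forall x, A x -> A (x * g) /\ A (x * g^-1) >].

Fact rstab_mul : mulg_closed rstab.
Proof.
move=> g h /asboolP hg /asboolP hh; apply/asboolP => x Ax; rewrite invgM !mulgA.
split; first by have [/hh[]] := hg _ Ax.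
by have [_ /hg[]] := hh _ Ax.
Qed.

Fact rstab_one : 1 \in rstab.
Proof. by apply/asboolP => x Ax; rewrite invg1 mulg1. Qed.

Fact rstab_inv : invg_closed rstab.
Proof. by move=> g /asboolP hg; apply/asboolP => x /hg[? ?]; rewrite invgK. Qed.

HB.instance Definition _ := isMulClosed.Build G rstab rstab_mul.
HB.instance Definition _ := isMul1Closed.Build G rstab rstab_one.
HB.instance Definition _ := isInvClosed.Build G rstab rstab_inv.

End RightStabiliser.

Section Generation.
Variable G : groupType.
Implicit Types (x y : G) (Y Z A : set G) (H : groupClosed G).

Lemma gen_ind Y A : A 1 ->
  (forall x y, A x -> Y y -> A (x * y)) ->
  (forall x y, A x -> Y y -> A (x * y^-1)) ->
  forall x, x \in gen Y -> A x.
Proof.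
move=> A1 AM AV x /asboolP/(_ (rstab A)) xA.
have /asboolP/(_ 1 A1)[] : x \in rstab A; last by rewrite mul1g.
apply: xA => y; rewrite inE => Yy.
by apply/asboolP => z Az; split; [apply: AM|apply: AV].
Qed.

Lemma gen_min Y A : A 1 -> (forall x y, A x -> A y -> A (x * y)) ->
  (forall x, A x -> A x^-1) -> Y `<=` A ->
  forall x, x \in gen Y -> A x.
Proof.
move=> A1 AM AV YA; apply: gen_ind => // x y Ax /YA Ay; apply: AM => //.
exact: AV.
Qed.

Lemma mem_gen Y x : Y x -> x \in gen Y.
Proof. by move=> Yx; apply: sub_gen; rewrite inE. Qed.

Lemma gen_subP Y H : (forall x, Y x -> x \in H) ->
  forall x, x \in gen Y -> x \in H.
Proof.
move=> YH; apply: gen_min => [|x y|x|//]; [exact: gpred1|exact: gpredM|].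
by rewrite gpredV.
Qed.

Lemma genS Y Z : Y `<=` Z -> forall x, x \in gen Y -> x \in gen Z.
Proof. by move=> YZ; apply: gen_subP => x /YZ; apply: mem_gen. Qed.

End Generation.

(** Sections, restrictions and letter actions are morphisms only on a subgroup
    of the automorphism group of the tree; keeping them as functions on the whole
    group avoids transporting everything through subtypes. *)
Section PartialMorphisms.
Variables (G K : groupType) (H : groupClosed G) (f : G -> K).
Hypothesis fM : {in H &, {morph f : x y / x * y}}.

Lemma pmorph1 : f 1 = 1.
Proof.
by apply: (mulgI (f 1)); rewrite -fM ?gpred1 // !mulg1.
Qed.

Lemma pmorphV : {in H, {morph f : x / x^-1}}.
Proof.
move=> x xH; apply: (mulgI (f x)); rewrite -fM ?gpredV //.
by rewrite !mulgV pmorph1.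
Qed.

Lemma pmorph_gen (Y : set G) : (forall x, Y x -> x \in H) ->
  forall x, x \in gen Y -> f x \in gen (f @` Y).
Proof.
move=> YH x xY; suff [] : x \in H /\ f x \in gen (f @` Y) by [].
move: x xY; apply: gen_min => [|x y [xH fx] [yH fy]|x [xH fx]|x Yx].
- by rewrite pmorph1 !gpred1.
- by rewrite fM // !gpredM.
- by rewrite pmorphV // !gpredV.
- by split; [apply: YH | apply: mem_gen; exists x].
Qed.

End PartialMorphisms.

(** * Locally finite subsets *)

(** Induction on the coordinates: a set whose image under one coordinate is
    finite is a finite union of fibres, on which one coordinate fewer has to
    separate points. *)
Lemma finite_set_separated (T : Type) (I : finType) (U : I -> Type)
    (f : forall i, T -> U i) (A : set T) :
  (forall i, finite_set (f i @` A)) ->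
  (forall x y, A x -> A y -> (forall i, f i x = f i y) -> x = y) ->
  finite_set A.
Proof.
move=> fin sep.
suff gen_s (s : seq I) (B : set T) : B `<=` A ->
    (forall x y, B x -> B y -> {in s, forall i, f i x = f i y} -> x = y) ->
    finite_set B.
  apply: (gen_s (enum I)) => // x y Ax Ay E; apply: sep => // i.
  by apply: E; rewrite mem_enum.
elim: s B => [|i s IH] B BA sepB.
  have [[x Bx]|B0] := pselect (B !=set0); last first.
    by rewrite (_ : B = set0) //; apply: contrapT => /eqP/set0P.
  by apply: sub_finite_set (finite_set1 x) => y By; apply: sepB.
have BE : B `<=` \bigcup_(u in f i @` A) [set x | B x /\ f i x = u].
  by move=> x Bx; exists (f i x) => //; exists x => //; apply: BA.
apply: (sub_finite_set BE); apply: bigcup_finite => // u _.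
apply: IH => [x [/BA]//|x y [Bx fx] [By fy] E]; apply: sepB => // j.
by rewrite inE => /orP[/eqP->|/E//]; rewrite fx fy.
Qed.

(** For a set N that is a subgroup, this is local finiteness of N; phrasing it
    for subsets lets kernels of partial morphisms be used as they come. *)
Definition lf (G : groupType) (N : set G) : Prop :=
  forall Z : set G, finite_set Z -> Z `<=` N -> finite_set [set x | x \in gen Z].

Section LocallyFinite.
Variable G : groupType.
Implicit Types (H : groupClosed G) (N M Z : set G).

Lemma lfS N M : N `<=` M -> lf M -> lf N.
Proof. by move=> NM lfM Z fZ ZN; apply: lfM => // x /ZN/NM. Qed.

Lemma lf1 : lf [set 1 : G].
Proof.
move=> Z _ Z1; apply: sub_finite_set (finite_set1 1) => x /=.
by apply: (@gen_min _ Z [set 1]) => // [_ _ -> ->|_ ->]; rewrite ?mulg1 ?invg1.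
Qed.

(** For a finite Z, each coordinate maps [gen Z] into the group generated by
    the image of Z, which is finite; so [gen Z] sits in a finite product of
    finite sets. *)
Lemma lf_separated N (I : finType) (K : I -> groupType)
    (f : forall i, G -> K i) (M : forall i, set (K i)) :
  (forall i, {in gen N &, {morph f i : x y / x * y}}) ->
  (forall i x, N x -> M i (f i x)) ->
  (forall i, lf (M i)) ->
  {in gen N &, forall x y, (forall i, f i x = f i y) -> x = y} ->
  lf N.
Proof.
move=> fM fN lfM sep Z finZ ZN.
apply: (@finite_set_separated _ _ K f) => [i|x y /= xZ yZ]; last first.
  by apply: sep; [exact: (genS ZN)|exact: (genS ZN)].
apply: (@sub_finite_set _ _ [set u | u \in gen (f i @` Z)]).
  move=> _ [x xZ <-] /=; apply: (pmorph_gen _ _ xZ) => [|z /ZN]; last exact: mem_gen.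
  exact: fM.
apply: lfM; first exact: finite_image.
by move=> _ [z /ZN Nz <-]; apply: fN.
Qed.

(** The coordinates I may be infinite in number, but a finite set Z gives each
    coordinate a profile, the tuple of values of Z there, and there are finitely
    many profiles.  Coordinates with the same profile agree on all of [gen Z], so
    one coordinate for each profile separates [gen Z]. *)
Lemma lf_residually_bounded N (I : Type) (F : finGroupType) (f : I -> G -> F) :
  (forall i, {in gen N &, {morph f i : x y / x * y}}) ->
  {in gen N &, forall x y, (forall i, f i x = f i y) -> x = y} ->
  lf N.
Proof.
move=> fM sep Z finZ ZN.
have [s Zs] := (finite_seqP Z).1 finZ.
pose profile i := [tuple of map (f i) (in_tuple s)].
have prof i j : profile i = profile j -> forall x, x \in gen Z -> f i x = f j x.
  move=> ij x xZ; suff [] : x \in gen N /\ f i x = f j x by [].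
  move: x xZ; apply: gen_min => [|x y [xN fx] [yN fy]|x [xN fx]|x Zx].
  - by split; [apply: gpred1 | rewrite !(pmorph1 (fM _))].
  - by split; [apply: gpredM | rewrite !fM // fx fy].
  - by split; [rewrite gpredV | rewrite !(pmorphV (fM _)) // fx].
  split; first exact/mem_gen/ZN.
  have /eq_in_map : [seq f i x | x <- s] = [seq f j x | x <- s].
    by have := congr1 val ij.
  by apply; have := Zx; rewrite Zs.
(* The value 1 is a filler for the profiles that do not occur. *)
pose val_at (t : (size s).-tuple F) (x : G) : F :=
  if pselect (exists i, profile i = t) is left e then f (sval (cid e)) x else 1.
apply: (@finite_set_separated _ _ (fun=> F) val_at).
  by move=> t; apply: finite_finset.
move=> x y xZ yZ E; apply: sep => [||i]; try exact: (genS ZN).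
have := E (profile i); rewrite /val_at; case: pselect => [e|[]]; last by exists i.
by case: cid => j /= ji; rewrite !(prof _ _ ji).
Qed.

End LocallyFinite.

Lemma lf_dprod (I : finType) (K : I -> groupType) (M : forall i, set (K i)) :
  (forall i, lf (M i)) -> lf [set h : dprodg K | forall i, M i (h i)].
Proof.
move=> lfM; apply: (@lf_separated _ _ _ K (fun i (h : dprodg K) => h i) M) => //.
by move=> x y _ _ E; apply: functional_extensionality_dep.
Qed.

(** Schreier's argument.  Given a finite Z, the image of [gen Z] is a finite set
    B; with a transversal t of B and S the set of elements of Z and their
    inverses, the finitely many elements t(b) s t(b f(s))^-1 lie in the kernel
    and generate a finite group U.  Then U t(B) is finite and closed under right
    multiplication by S, so it contains t(1) [gen Z]. *)
Lemma lf_extension (G K : groupType) (H : groupClosed G) (f : G -> K) (M : set K) :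
  {in H &, {morph f : x y / x * y}} ->
  lf [set x | x \in H /\ f x = 1] -> lf M ->
  lf [set x | x \in H /\ M (f x)].
Proof.
move=> fM lfN lfM Z finZ ZHM.
have ZH x : Z x -> x \in H by case/ZHM.
pose B := [set b | b \in gen (f @` Z)].
have finB : finite_set B.
  apply: lfM; first exact: finite_image.
  by move=> _ [z /ZHM[_ ?] <-].
pose t (b : K) : G := xget 1 [set g | g \in H /\ f g = b].
have tP b : B b -> t b \in H /\ f (t b) = b.
  move=> Bb; rewrite /t; case: xgetP => [g _ []//|/(_ _)noB].
  suff [g hg] : exists g, g \in H /\ f g = b by case: (noB g).
  move: b Bb {noB}; apply: gen_min => [|_ _ [x [xH <-]] [y [yH <-]]|_ [x [xH <-]]|].
  - by exists 1; rewrite gpred1 (pmorph1 fM).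
  - by exists (x * y); rewrite gpredM // fM.
  - by exists x^-1; rewrite gpredV (pmorphV fM).
  - by move=> _ [z /ZH zH <-]; exists z.
pose S := Z `|` [set z^-1 | z in Z].
have finS : finite_set S by rewrite finite_setU; split=> //; apply: finite_image.
have SP s : S s -> s \in H /\ B (f s).
  case=> [Zs|[z Zz <-]]; rewrite /B /=.
    by split; [exact: ZH | apply: mem_gen; exists s].
  have zH := ZH _ Zz; rewrite gpredV (pmorphV fM) // gpredV; split=> //.
  by apply: mem_gen; exists z.
pose r (b : K) (s : G) := t b * s * (t (b * f s))^-1.
pose R := [set r b s | b in B & s in S].
have rP b s : B b -> S s -> r b s \in H /\ f (r b s) = 1.
  move=> Bb Ss; have [tH ft] := tP _ Bb; have [sH Bs] := SP _ Ss.
  have [tH' ft'] : t (b * f s) \in H /\ f (t (b * f s)) = b * f s.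
    by apply: tP; apply: gpredM.
  split; first by rewrite gpredM ?gpredV // gpredM.
  by rewrite !fM ?gpredM ?gpredV // (pmorphV fM) // ft ft' mulgV.
pose A := [set u * t b | u in [set u | u \in gen R] & b in B].
have finA : finite_set A.
  apply: finite_image2 => //; apply: lfN; first exact: finite_image2.
  by move=> _ [b Bb [s Ss <-]]; apply: rP.
have AS x s : A x -> S s -> A (x * s).
  move=> [u uR [b Bb <-]] Ss; exists (u * r b s).
    by apply: gpredM => //; apply: mem_gen; exists b => //; exists s.
  exists (b * f s); first by apply: gpredM => //; have [] := SP _ Ss.
  by rewrite /r !mulgA mulgVK.
apply: (@sub_finite_set _ _ [set (t 1)^-1 * a | a in A]); last exact: finite_image.
move=> x xZ; exists (t 1 * x); last by rewrite mulKg.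
move: x xZ; apply: (@gen_ind _ Z (fun x => A (t 1 * x))) => [|x y Ax Zy|x y Ax Zy].
- by rewrite mulg1; exists 1; [exact: gpred1|exists 1; [exact: gpred1|rewrite mul1g]].
- by rewrite mulgA; apply: AS => //; left.
- by rewrite mulgA; apply: AS => //; right; exists y.
Qed.

(** * Wreath products with the symmetric group of a finite set *)

Section Wreath.
Variables (L : groupType) (X : finType).

Definition wreath : Type := ((X -> L) * {perm X})%type.
HB.instance Definition _ := Choice.on wreath.

(** The components follow the cocycle rule (gh)_x = g_(h x) h_x of sections;
    the permutation attached to h acts by its inverse because the product of
    permutations reads from left to right. *)
Definition wreath_mul (a b : wreath) : wreath :=
  (fun x => a.1 (b.2^-1 x) * b.1 x, a.2 * b.2).
Definition wreath_one : wreath := (fun=> 1, 1).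
Definition wreath_inv (a : wreath) : wreath :=
  (fun x => (a.1 (a.2 x))^-1, a.2^-1).

Fact wreath_mulA : associative wreath_mul.
Proof.
move=> a b c; congr (_, _) => /=; last exact: mulgA.
by apply/funext => x; rewrite invMg permM mulgA.
Qed.
Fact wreath_mul1 : left_id wreath_one wreath_mul.
Proof.
move=> [a s]; congr (_, _) => /=; last exact: mul1g.
by apply/funext => x; rewrite mul1g.
Qed.
Fact wreath_mulr1 : right_id wreath_one wreath_mul.
Proof.
move=> [a s]; congr (_, _) => /=; last exact: mulg1.
by apply/funext => x; rewrite mulg1 invg1 perm1.
Qed.
Fact wreath_mulV : left_inverse wreath_one wreath_inv wreath_mul.
Proof.
move=> [a s]; congr (_, _) => /=; last exact: mulVg.
by apply/funext => x; rewrite permKV mulVg.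
Qed.
Fact wreath_mulrV : right_inverse wreath_one wreath_inv wreath_mul.
Proof.
move=> [a s]; congr (_, _) => /=; last exact: mulgV.
by apply/funext => x; rewrite invgK mulgV.
Qed.

HB.instance Definition _ := isGroup.Build wreath
  wreath_mulA wreath_mul1 wreath_mulr1 wreath_mulV wreath_mulrV.

Definition wreath_base : {pred wreath} := fun a => a.2 == 1.
Lemma wreath_baseE a : (a \in wreath_base) = (a.2 == 1). Proof. by []. Qed.
Fact wreath_base_mul : mulg_closed wreath_base.
Proof. by move=> a b /eqP a1 /eqP b1; rewrite wreath_baseE /= a1 b1 mulg1. Qed.
Fact wreath_base_one : 1 \in wreath_base. Proof. exact: eqxx. Qed.
Fact wreath_base_inv : invg_closed wreath_base.
Proof. by move=> a /eqP a1; rewrite wreath_baseE /= a1 invg1. Qed.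
HB.instance Definition _ := isMulClosed.Build wreath wreath_base wreath_base_mul.
HB.instance Definition _ := isMul1Closed.Build wreath wreath_base wreath_base_one.
HB.instance Definition _ := isInvClosed.Build wreath wreath_base wreath_base_inv.

Lemma wreath_base_normal : normal_subgrp wreath_base.
Proof.
by move=> a b /eqP a1; rewrite wreath_baseE /= a1 mul1g mulVg.
Qed.

Lemma wreath_quot_finite : finite_group (quot wreath_base_normal).
Proof.
pose q (s : {perm X}) := coset_of wreath_base_normal ((fun=> 1, s) : wreath).
apply: (@sub_finite_set _ _ (q @` setT)); last first.
  exact/finite_image/finite_finset.
move=> u _; rewrite -(coset_of_repr u); exists (repr u).2 => //.
by apply/coset_of_eqP; rewrite wreath_baseE /= mulVg.
Qed.

End Wreath.

(** * Homomorphisms with locally finite kernel *)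

Section LfBy.
Variable P : groupType -> Prop.
Hypothesis P_isom : isom_invariant P.
Hypothesis P_subgroup : forall (G : groupType) (H : groupClosed G),
  P G -> P (subgrp H).

(** G is isomorphic to the subgroup of K that is its image; that image is
    written as [gen (range f)] to have it as a subgroup at once. *)
Lemma embedding_property (G K : groupType) (f : G -> K) :
  {morph f : x y / x * y} -> injective f -> P K -> P G.
Proof.
move=> fM fI /(P_subgroup (gen (range f))) PI; apply: P_isom PI.
have fM' : {in gen setT &, {morph f : x y / x * y}} by move=> x y _ _; apply: fM.
have im k : k \in gen (range f) -> exists x, f x = k.
  move: k; apply: gen_min => [|_ _ [x <-] [y <-]|_ [x <-]|_ [x _ <-]].
  - by exists 1; rewrite (pmorph1 fM').
  - by exists (x * y).
  - by exists x^-1; rewrite (pmorphV fM') //; apply: mem_gen.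
  - by exists x.
pose g (u : subgrp (gen (range f))) : G := sval (cid (im _ (valP u))).
have fg u : f (g u) = val u by rewrite /g; case: cid.
have gM : {morph g : u v / u * v}.
  by move=> u v; apply: fI; rewrite fM !fg.
have memf x : f x \in gen (range f) by apply: mem_gen; exists x.
pose g' := HB.pack_for {multiplicative (subgrp (gen (range f))) -> G} g
  (isMultiplicative.Build _ _ g gM).
exists g'; exists (fun x => Sub (f x) (memf x)) => [u|x] /=.
  by apply: val_inj; rewrite SubK fg.
by apply: fI; rewrite fg SubK.
Qed.

(** The base of the wreath product is a finite power of L, and the quotient by
    it is a quotient of the finite set of permutations. *)
Lemma wreath_property :
  (forall (I : finType) (G : I -> groupType), (forall i, P (G i)) -> P (dprodg G)) ->
  (forall G : groupType, group_by P finite_group G -> P G) ->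
  forall (L : groupType) (X : finType), P L -> P (wreath L X).
Proof.
move=> P_product P_by_finite L X PL; apply: P_by_finite.
exists (@wreath_base L X : groupClosed _), (@wreath_base_normal L X); split; last first.
  exact: wreath_quot_finite.
pose f (u : subgrp (@wreath_base L X)) : dprodg (fun _ : X => L) := (val u).1.
have base1 (u : subgrp (@wreath_base L X)) : (val u).2 = 1 by apply/eqP/(valP u).
apply: (@embedding_property _ _ f) => [u v|u v uv|]; last exact: P_product.
  by apply/funext => x; rewrite /f /= base1 invg1 perm1.
apply: val_inj; move: (base1 u) (base1 v) uv; rewrite /f.
by case: (val u) => ? ?; case: (val v) => ? ? /= -> -> ->.
Qed.

(** Being (locally finite)-by-P, for a subgroup H and up to passing to a
    subgroup of the quotient: no surjectivity is asked, so that homomorphisms can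
    be composed and assembled into products freely. *)
Definition lf_by (G : groupType) (H : {pred G}) : Prop :=
  exists (L : groupType) (f : G -> L),
    [/\ {in H &, {morph f : x y / x * y}}, P L & lf [set x | x \in H /\ f x = 1]].

(** The quotient by the kernel embeds into L, hence inherits P. *)
Lemma lf_by_group_by (G : groupType) (H : groupClosed G) :
  lf_by H -> group_by locally_finite P (subgrp H).
Proof.
move=> [L [f [fM PL lfN]]].
pose f' (u : subgrp H) : L := f (val u).
have f'M : {morph f' : u v / u * v} by move=> u v; apply: fM; apply: valP.
have f'M' : {in gen setT &, {morph f' : x y / x * y}} by move=> ? ? _ _; apply: f'M.
have f'V x : f' x^-1 = (f' x)^-1 by apply: (pmorphV f'M'); apply: mem_gen.
have f'1 : f' 1 = 1 := pmorph1 f'M'.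
pose N := [set u | f' u = 1].
have NE u : u \in gen N -> f' u = 1.
  move: u; apply: gen_min => // [u v u1 v1|u u1]; first by rewrite f'M u1 v1 mulg1.
  by rewrite f'V u1 invg1.
have nN : normal_subgrp (gen N).
  move=> u v /NE u1; apply: mem_gen; rewrite /N /= /conjg !f'M u1 f'V.
  by rewrite mul1g mulVg.
exists (gen N : groupClosed _), nN; split.
  move=> Z finZ.
  pose j (u : subgrp (gen N)) : G := val (val u).
  have jI : injective j by move=> u v /val_inj/val_inj.
  have jM : {in gen setT &, {morph j : u v / u * v}} by [].
  have fin : finite_set [set x | x \in gen (j @` Z)].
    apply: lfN; first exact: finite_image.
    move=> _ [z Zz <-]; split; first exact: valP.
    exact/NE/valP.
  apply: sub_finite_set (finite_preimage (f := j) _ fin) => [z zZ|? ? _ _ /jI//].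
  by apply: (pmorph_gen jM) zZ => *; apply: mem_gen.
pose q (a : quot nN) : L := f' (repr a).
have qE u : q (coset_of nN u) = f' u.
  have /coset_of_eqP/NE := coset_of_repr (coset_of nN u).
  by rewrite f'M f'V -/(q _) => E; rewrite -[RHS](mulKVg (q (coset_of nN u))) E mulg1.
apply: (@embedding_property _ _ q) => // [a b|a b].
  have cM u v : coset_of nN u * coset_of nN v = coset_of nN (u * v).
    exact: coset_ofM.
  by rewrite -(coset_of_repr a) -(coset_of_repr b) cM !qE f'M.
rewrite -(coset_of_repr a) -(coset_of_repr b) !qE => ab.
by apply/coset_of_eqP/mem_gen; rewrite /N /= f'M f'V ab mulVg.
Qed.

End LfBy.

(** * Letters, sections and directed automorphisms *)

Section LetterAction.
Variable X : finType.
Implicit Types (g h k : aut X) (x y z : X) (u v w : seq X) (Y : set (aut X)).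

Lemma aut_nil g : g [::] = [::].
Proof.
have : prefix (g [::]) (g (g^-1 [::])) by rewrite -aut_prefix prefix0s.
by rewrite aut_invKV prefixs0 => /eqP.
Qed.

Lemma aut_inj g : injective g. Proof. exact: bij_inj (aut_bij g). Qed.

Lemma aut_mulE g h w : (g * h) w = g (h w). Proof. by []. Qed.

Lemma aut_invE g w : g^-1 (g w) = w. Proof. exact: aut_invK. Qed.

(** The letter g(x); the default value of [head] is never taken, see [lactE]. *)
Definition lact g x : X := head x (g [:: x]).

Lemma lactE g x : g [:: x] = [:: lact g x].
Proof.
rewrite /lact; case E: (g [:: x]) => [|a s] //=.
  by move: E; rewrite -(aut_nil g) => /aut_inj.
have : prefix (g^-1 [:: a]) [:: x].
  by rewrite (aut_prefix g) aut_invKV E /= eqxx prefix0s.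
case D: (g^-1 [:: a]) => [|b t].
  by have := aut_invKV g [:: a]; rewrite D aut_nil.
rewrite prefix_cons => /andP[/eqP bx]; rewrite prefixs0 => /eqP t0.
by move: (aut_invKV g [:: a]); rewrite D bx t0 E => -[->].
Qed.

Lemma aut_cons g x w : g (x :: w) = lact g x :: section g [:: x] w.
Proof. by rewrite -cat1s sectionE lactE. Qed.

Lemma lactM g h x : lact (g * h) x = lact g (lact h x).
Proof. by rewrite {1}/lact aut_mulE !lactE. Qed.

Lemma lactK g : cancel (lact g) (lact g^-1).
Proof. by move=> x; rewrite -lactM mulVg. Qed.

Lemma lactKV g : cancel (lact g^-1) (lact g).
Proof. by move=> x; rewrite -lactM mulgV. Qed.

Lemma lactP g x y : g [:: x] = [:: y] <-> lact g x = y.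
Proof. by rewrite lactE; split=> [[]|->]. Qed.

Lemma sectionM g h w : section (g * h) w = section g (h w) * section h w.
Proof.
by apply/esym/section_unique => u; rewrite !aut_mulE !sectionE.
Qed.

Lemma section1 w : section (1 : aut X) w = 1.
Proof. exact/esym/section_unique. Qed.

Lemma sectionV g w : section g^-1 w = (section g (g^-1 w))^-1.
Proof.
apply: (mulgI (section g (g^-1 w))).
by rewrite -sectionM mulgV section1 mulgV.
Qed.

Lemma section_nil g : section g [::] = g.
Proof. by apply/esym/section_unique => u; rewrite aut_nil. Qed.

Lemma section_cat g u v : section g (u ++ v) = section (section g u) v.
Proof.
apply: aut_ext => w; have := sectionE g (u ++ v) w; rewrite -catA !sectionE -catA.
by move=> /eqP; rewrite !eqseq_cat // !eqxx => /eqP.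
Qed.

Lemma aut_letter_ext g h :
  (forall x, lact g x = lact h x) ->
  (forall x, section g [:: x] = section h [:: x]) -> g = h.
Proof.
move=> lE sE; apply: aut_ext => -[|x w]; first by rewrite !aut_nil.
by rewrite !aut_cons lE sE.
Qed.

(** The action of g^-1, so that [letter_perm] is a morphism for the
    left-to-right product of permutations. *)
Definition letter_perm g : {perm X} := perm (can_inj (lactKV g)).

Lemma letter_permM : {morph letter_perm : g h / g * h}.
Proof. by move=> g h; apply/perm.permP => x; rewrite permM !permE invgM lactM. Qed.

Lemma letter_permVE g x : (letter_perm g)^-1 x = lact g x.
Proof. rewrite -{1}(lactK g x) -[lact g^-1 _](permE (can_inj (lactKV g))).
by rewrite permK. Qed.

Lemma letter_perm1 : letter_perm 1 = 1.
Proof. by apply: (mulgI (letter_perm 1)); rewrite -letter_permM !mulg1. Qed.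

Lemma letter_permV g : letter_perm g^-1 = (letter_perm g)^-1.
Proof.
by apply: (mulgI (letter_perm g)); rewrite -letter_permM !mulgV letter_perm1.
Qed.

(** The cocycle rule (gh)_x = g_(h x) h_x propagates a property of the letter
    sections of generators, at letters in an invariant set D, to the whole group. *)
Lemma gen_section Y (H : groupClosed (aut X)) (D : pred X) :
  (forall g x, Y g -> D (lact g x) = D x) ->
  (forall g x, Y g -> D x -> section g [:: x] \in H) ->
  forall g, g \in gen Y -> forall x, D x -> section g [:: x] \in H.
Proof.
move=> YD YH g gY.
suff [] : (forall x, D (lact g x) = D x) /\
  (forall x, D x -> section g [:: x] \in H) by [].
move: g gY; apply: gen_min => [|g h [gD gH] [hD hH]|g [gD gH]|g Yg].
- by split=> // x _; rewrite section1 gpred1.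
- split=> [x|x Dx]; first by rewrite lactM gD hD.
  by rewrite sectionM lactE gpredM ?hH // gH // hD.
- split=> [x|x Dx]; first by rewrite -[in RHS](lactKV g x) gD.
  by rewrite sectionV lactE gpredV gH // -gD lactKV.
- by split=> x; [apply: YD | apply: YH].
Qed.

End LetterAction.

(** * Groups generated by directed automorphisms *)

Section Directed.
Variable X : finType.
Implicit Types (g h k : aut X) (x y z a : X) (u v w : seq X) (Y : set (aut X)).

(** The identity is directed at every letter; this is harmless, and makes the
    elements of a distinguished generating set fall under [directed] or have
    trivial letter sections. *)
Definition directed_at g a : Prop :=
  section g [:: a] = g /\ forall x, x != a -> section g [:: x] = 1.

Definition directed Y : set (aut X) := [set g | Y g /\ exists a, directed_at g a].

Lemma gen_basilica_cases Y g : gen_basilica Y -> Y g ->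
  directed Y g \/ forall x, section g [:: x] = 1.
Proof.
move=> [_ YB] Yg; have [|[g1g [a [ga aP]]]] := YB g Yg; [by right|left].
split=> //; exists a; split=> // x xa.
by have [//|/aP ax] := g1g x; rewrite ax eqxx in xa.
Qed.

Lemma directed_section Y g x : Y g -> (exists a, directed_at g a) ->
  section g [:: x] \in gen Y.
Proof.
move=> Yg [a [ga g1]]; have [->|/g1->] := eqVneq x a; last exact: gpred1.
by rewrite ga; apply: mem_gen.
Qed.

Lemma gen_basilica_section Y : gen_basilica Y ->
  forall g, g \in gen Y -> forall x, section g [:: x] \in gen (directed Y).
Proof.
move=> YB g gY x; apply: (@gen_section _ Y _ predT) gY _ _ => // h y Yh _.
have [dh|->] := gen_basilica_cases YB Yh; last exact: gpred1.
by apply: directed_section => //; have [] := dh.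
Qed.

Lemma gen_basilica_sub Y Y' : gen_basilica Y -> Y' `<=` Y -> gen_basilica Y'.
Proof.
by move=> [finY YB] YY; split=> [|g /YY/YB//]; apply: sub_finite_set finY.
Qed.

Section Transitive.
Variable Y : set (aut X).
Hypothesis Ydir : forall g, Y g -> exists a, directed_at g a.

(** Connectedness of X along edges with trivial label. *)
Definition slide x y := exists h, [/\ h \in gen Y, lact h x = y & section h [:: x] = 1].

Lemma slide_refl x : slide x x.
Proof. by exists 1; rewrite gpred1 section1. Qed.

Lemma slide_trans y x z : slide x y -> slide y z -> slide x z.
Proof.
move=> [h [hY hx h1]] [k [kY ky k1]]; exists (k * h).
by rewrite gpredM // lactM sectionM lactE hx ky k1 h1 mulg1.
Qed.

Lemma slide_sym x y : slide x y -> slide y x.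
Proof.
move=> [h [hY hx h1]]; exists h^-1.
by rewrite gpredV -hx lactK sectionV lactE lactK h1 invg1.
Qed.

(** The only edge of g with a nontrivial label starts at the letter a where g is
    directed.  If the cycle of g could not be followed from g(a) back to a along
    trivial labels, then all iterates of g on g(a) would be different from a,
    against the finite order of the action of g on X. *)
Lemma slide_generator g x : Y g -> slide x (lact g x).
Proof.
move=> Yg; have [a [ga g1]] := Ydir Yg.
have step y : y != a -> slide y (lact g y).
  by move=> /g1 gy; exists g; rewrite gy; split=> //; apply: mem_gen.
have [->|/step//] := eqVneq x a; apply: slide_sym; apply: contrapT => nslide.
pose p : {perm X} := perm (can_inj (lactK g)).
have iter_slide i : slide (lact g a) (iter i p (lact g a)).
  elim: i => [|i IH]; first exact: slide_refl.
  apply: (slide_trans IH); rewrite iterS permE; apply: step.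
  by apply/eqP => E; apply: nslide; rewrite E in IH.
apply: nslide; have := iter_slide #[p].-1.
have pa : lact g a = p a by rewrite permE.
by rewrite {2}pa -iterSr prednK ?order_gt0 // -permX expg_order perm1.
Qed.

Lemma slide_orbit g x : g \in gen Y -> slide x (lact g x).
Proof.
move=> gY; move: g gY x; apply: gen_min => [x|g h gP hP x|g gP x|g Yg x].
- exact: slide_refl.
- by rewrite lactM; apply: slide_trans (hP _) (gP _).
- by apply: slide_sym; rewrite -{2}(lactKV g x); apply: gP.
- exact: slide_generator.
Qed.

Lemma directed_self_similar : self_similar (gen Y).
Proof.
move=> g w gY; elim: w g gY => [|x w IH] g gY; first by rewrite section_nil.
rewrite -cat1s section_cat; apply: IH.
apply: (@gen_section _ Y _ predT) gY _ _ => // h y Yh _.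
exact: directed_section (Ydir Yh).
Qed.

(** To realise a generator g, directed at a, as a section at x: slide from x to
    a, apply g, and slide back from g(a) to x. *)
Lemma directed_self_replicating :
  letter_transitive (gen Y) -> self_replicating (gen Y).
Proof.
move=> tr; split=> //; first exact: directed_self_similar.
have sl x y : slide x y.
  by have [g gY /lactP <-] := tr x y; apply: slide_orbit.
move=> x; apply/seteqP; split=> [_ [g [gY _] <-]|]; first exact: directed_self_similar.
move=> g /=; move: g; apply: gen_min.
- by exists 1; [split; [exact: gpred1|] | exact: section1].
- move=> _ _ [g [gY gx] <-] [h [hY hx] <-]; exists (g * h).
    by split; [exact: gpredM | rewrite aut_mulE hx gx].
  by rewrite sectionM hx.
- move=> _ [g [gY gx] <-]; exists g^-1; last by rewrite sectionV -{1}gx aut_invE.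
  by split; [rewrite gpredV | rewrite -{1}gx aut_invE].
- move=> g Yg; have [a [ga _]] := Ydir Yg.
  have [h [hY hx h1]] := sl x a; have [k [kY kx k1]] := sl (lact g a) x.
  exists (k * (g * h)).
    split; last by rewrite !aut_mulE !(lactE, hx, kx).
    by rewrite !gpredM //; apply: mem_gen.
  by rewrite !(sectionM, aut_mulE) !(lactE, hx) k1 ga h1 mul1g mulg1.
Qed.

End Transitive.

Section Orbits.
Variable Y : set (aut X).

Definition orb x : {set X} := [set y | `[< exists2 g, g \in gen Y & lact g x = y >]]%SET.

Lemma orbP x y : reflect (exists2 g, g \in gen Y & lact g x = y) (y \in orb x).
Proof. by rewrite inE; apply: asboolP. Qed.

Lemma orb_refl x : x \in orb x.
Proof. by apply/orbP; exists 1 => //; apply: gpred1. Qed.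

Lemma orb_lact g x y : g \in gen Y -> (lact g y \in orb x) = (y \in orb x).
Proof.
move=> gY; apply/orbP/orbP => -[h hY hx].
  by exists (g^-1 * h); rewrite ?gpredM ?gpredV // lactM hx lactK.
by exists (g * h); rewrite ?gpredM // lactM hx.
Qed.

Lemma orb_preserved x : preserved (gen Y) (orb x).
Proof.
move=> g gY; apply/seteqP; split=> [_ [y yO <-]|_ [y yO <-]].
  by exists (lact g y); [rewrite /= orb_lact | rewrite lactE].
exists (lact g^-1 y); last by rewrite lactE lactKV.
by rewrite /= orb_lact // gpredV.
Qed.

Hypothesis Ydir : forall g, Y g -> exists a, directed_at g a.

Definition directed_in (O : {set X}) : set (aut X) :=
  [set g | Y g /\ exists2 a, a \in O & directed_at g a].

Lemma section_orbit x : forall g, g \in gen Y -> forall y, y \in orb x ->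
  section g [:: y] \in gen (directed_in (orb x)).
Proof.
apply: gen_section => g y Yg; first by apply/orb_lact/mem_gen.
move=> yO; have [a [ga g1]] := Ydir Yg.
have [ya|/g1->] := eqVneq y a; last exact: gpred1.
by rewrite ya in yO *; rewrite ga; apply: mem_gen; split=> //; exists a.
Qed.

(** A generator directed at a letter of an orbit has trivial section at the
    letters of the other orbits. *)
Lemma section_off_orbit x g y : g \in gen (directed_in (orb x)) ->
  y \notin orb x -> section g [:: y] = 1.
Proof.
move=> gY yO; suff : section g [:: y] \in gen [set 1].
  by apply: (@gen_min _ _ [set 1]) => // [_ _ -> ->|_ ->]; rewrite ?mulg1 ?invg1.
move: gY y yO; apply: gen_section => {}g y [Yg [a aO [_ g1]]].
  by rewrite orb_lact //; apply: mem_gen.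
by move=> yO; rewrite g1 ?gpred1 //; apply: contraNneq yO => ->.
Qed.

Lemma section_orbit_word x g w : g \in gen Y -> w != [::] ->
  all (mem (orb x)) w -> section g w \in gen (directed_in (orb x)).
Proof.
have sub : forall h, h \in gen (directed_in (orb x)) -> h \in gen Y.
  by apply: genS => h [].
move=> gY; case: w => // y w _ /= /andP[yO].
elim: w g gY y yO => [|z w IH] g gY y yO; first by move=> _; apply: section_orbit.
move=> /= /andP[zO wO]; rewrite -cat1s section_cat; apply: IH => //.
exact/sub/section_orbit.
Qed.

(** Elements k of this kernel fix the words with letters in a single orbit, so
    the permutation of letters performed after such a word is multiplicative in
    k.  These permutations determine k, since the section of k becomes trivial at
    the first letter that leaves the orbit of the first one. *)
Lemma lf_orbit_kernel :
  lf [set k | k \in gen Y /\ forall x w, all (mem (orb x)) w -> k w = w].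
Proof.
set N := (X in lf X).
have NP : forall k, k \in gen N -> N k.
  apply: gen_min => // [|k l [kY kw] [lY lw]|k [kY kw]].
  - by split; first exact: gpred1.
  - split; first exact: gpredM.
    by move=> x w wO; rewrite aut_mulE (lw x) // (kw x).
  - split; first by rewrite gpredV.
    by move=> x w wO; rewrite -{1}(kw x w wO) aut_invE.
pose mono (w : seq X) := `[< exists x, all (mem (orb x)) w >].
pose f w k := if mono w then letter_perm (section k w) else 1.
apply: (@lf_residually_bounded _ _ _ _ f) => [w k l /NP[kY kw] /NP[lY lw]|k l].
  rewrite /f; case: ifP => [/asboolP[x wO]|_]; last by rewrite mulg1.
  by rewrite sectionM (lw x) // letter_permM.
move=> /NP[kY kw] /NP[lY lw] E.
have lE x w : all (mem (orb x)) w ->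
    forall y, lact (section k w) y = lact (section l w) y.
  move=> wO y; have mw : mono w by apply/asboolP; exists x.
  by have := E w; rewrite /f mw -!letter_permVE => ->.
have key x u : u != [::] -> all (mem (orb x)) u -> section k u = section l u.
  move=> u0 uO; apply: aut_ext => w; elim: w u u0 uO => [|y w IH] u u0 uO.
    by rewrite !aut_nil.
  rewrite !aut_cons (lE x) // -!section_cat; congr (_ :: _).
  case: (boolP (y \in orb x)) => yO.
    by apply: IH; [case: (u) | rewrite all_cat uO /= yO].
  by rewrite !section_cat !(@section_off_orbit x) // section_orbit_word.
apply: aut_letter_ext => x; last by apply: (key x); rewrite //= orb_refl.
by have := lE x [::] isT x; rewrite !section_nil.
Qed.

End Orbits.
End Directed.

(** * Restriction to an invariant alphabet *)

Section RestrictionMorphism.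
Variables (X : finType) (O : {set X}).
Implicit Types (g : aut X) (h : aut (alphabet O)).

Lemma restricts_inj g h h' : restricts g h -> restricts g h' -> h = h'.
Proof.
by move=> gh gh'; apply: aut_ext => w; apply: (inj_map val_inj); rewrite gh gh'.
Qed.

Lemma restrict_eq g h : restricts g h -> restrict O g = h.
Proof.
move=> gh; rewrite /restrict; case: xgetP => [k _ /restricts_inj|/(_ h)//]; exact.
Qed.

Lemma restricts1 : restricts 1 (1 : aut (alphabet O)). Proof. by []. Qed.

Lemma restrictsM g g' h h' :
  restricts g h -> restricts g' h' -> restricts (g * g') (h * h').
Proof. by move=> gh gh' w; rewrite !aut_mulE gh gh'. Qed.

Lemma restrictsV g h : restricts g h -> restricts g^-1 h^-1.
Proof.
by move=> gh w; apply: (@aut_inj _ g); rewrite -gh -!aut_mulE !mulgV.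
Qed.

(** Restriction commutes with sections, which is why it preserves the defining
    property of a distinguished generating set. *)
Lemma restricts_section g h (x : alphabet O) : restricts g h ->
  restricts (section g [:: val x]) (section h [:: x]).
Proof.
move=> gh w; have := gh (x :: w).
by rewrite map_cons !aut_cons map_cons => -[].
Qed.

Variable Y : set (aut X).
Hypotheses (YB : gen_basilica Y) (YO : preserved (gen Y) O).

Lemma restrict_gen g : g \in gen Y ->
  restricts g (restrict O g) /\ restrict O g \in gen (restrict O @` Y).
Proof.
move=> gY.
suff [h gh hY] : exists2 h, restricts g h & h \in gen (restrict O @` Y).
  by rewrite (restrict_eq gh).
move: g gY; apply: gen_min => [|g g' [h gh hY] [h' gh' hY']|g [h gh hY]|g Yg].
- by exists 1; [exact: restricts1 | exact: gpred1].
- by exists (h * h'); [exact: restrictsM | exact: gpredM].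
- by exists h^-1; [exact: restrictsV | rewrite gpredV].
- by exists (restrict O g); [exact: (restrictE YB) | apply: mem_gen; exists g].
Qed.

Lemma restrict_morph : {in gen Y &, {morph restrict O : g g' / g * g'}}.
Proof.
move=> g g' gY g'Y; apply/restrict_eq/restrictsM; exact: (restrict_gen _).1.
Qed.

(** A generator directed at a letter a restricts to one directed at a if a lies
    in O, and otherwise to one with trivial letter sections; in the first case
    the restriction may be 1, which falls in the class of trivial sections. *)
Lemma gen_basilica_restrict : gen_basilica (restrict O @` Y).
Proof.
split=> [|_ [g Yg <-]]; first exact: finite_image YB.1.
have gh := restrictE YB YO Yg; set h := restrict O g in gh *.
have sec1 (x : alphabet O) : section g [:: val x] = 1 -> section h [:: x] = 1.
  move=> g1; have := restricts_section x gh; rewrite g1 => /restricts_inj; apply.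
  exact: restricts1.
have secg (x : alphabet O) : section g [:: val x] = g -> section h [:: x] = h.
  by move=> gg; have := restricts_section x gh; rewrite gg => /restricts_inj; apply.
have [[_ [a [ga g1]]]|g1] := gen_basilica_cases YB Yg; last first.
  by left => x; apply: sec1.
have [aO|aO] := boolP (a \in O); last first.
  by left=> x; apply/sec1/g1; apply: contraNneq aO => <-; apply: valP.
pose b : alphabet O := Sub a aO.
have hb : section h [:: b] = h by apply: secg; rewrite SubK.
have hnb x : x != b -> section h [:: x] = 1.
  move=> xb; apply/sec1/g1; apply: contraNneq xb => xa.
  by apply/eqP/val_inj; rewrite SubK.
have [h1|h1] := eqVneq h 1; first by left=> x; rewrite h1 section1.
right; split=> [x|].
  by have [->|/hnb] := eqVneq x b; [right|left].
exists b; split=> // x hx; apply/esym/eqP; apply: contraNT h1 => /hnb.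
by rewrite hx => ->.
Qed.

End RestrictionMorphism.

(** * Reduction to the self-replicating case *)

Section Reductions.
Variable P : groupType -> Prop.

Lemma lf_by_of_property (G : groupType) (H : groupClosed G) :
  P (subgrp H) -> lf_by P H.
Proof.
move=> PH; pose f (g : G) : subgrp H := insubd 1 g.
have fE g : g \in H -> val (f g) = g by move=> gH; rewrite insubdK.
exists (subgrp H), f; split=> // [g h gH hH|].
  by apply: val_inj; rewrite fE ?gpredM //= !fE.
by apply: lfS (@lf1 G) => g [gH /(congr1 val)]; rewrite fE.
Qed.

(** The kernel consists of automorphisms that fix all letters, on which each
    letter section is a morphism; so it embeds into a finite power of the kernel
    of H -> L. *)
Lemma lf_by_letter_perm (X : finType) (Y : set (aut X))
    (H : groupClosed (aut X)) :
  (forall L : groupType, P L -> P (wreath L X)) ->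
  (forall g, g \in gen Y -> forall x, section g [:: x] \in H) ->
  lf_by P H -> lf_by P (gen Y).
Proof.
move=> Pw YH [L [f [fM PL lfN]]].
pose F (g : aut X) : wreath L X := (fun x => f (section g [:: x]), letter_perm g).
exists (wreath L X), F; split; [|exact: Pw|].
  move=> g h gY hY; congr (_, _); last exact: letter_permM.
  apply/funext => x; rewrite sectionM lactE fM ?YH //.
  by rewrite letter_permVE.
set N := (X in lf X).
have NP k : k \in gen N -> k \in gen Y /\ letter_perm k = 1.
  move: k; apply: gen_min => [|k l [kY k1] [lY l1]|k [kY k1]|k [kY [_ k1]] //].
  - by rewrite gpred1 letter_perm1.
  - by rewrite gpredM // letter_permM k1 l1 mulg1.
  - by rewrite gpredV letter_permV k1 invg1.
have lact_id (k : aut X) x : letter_perm k = 1 -> lact k x = x.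
  by move=> k1; rewrite -letter_permVE k1 invg1 perm1.
apply: (@lf_separated _ N X (fun=> aut X) (fun x g => section g [:: x])
         (fun=> [set h | h \in H /\ f h = 1])) => //.
- by move=> x k l _ /NP[_ l1]; rewrite sectionM lactE (lact_id l).
- move=> x k [kY Fk]; split; first exact: YH.
  by have := congr1 (fun a : wreath L X => a.1 x) Fk.
- move=> k l /NP[_ k1] /NP[_ l1] E; apply: aut_letter_ext => // x.
  by rewrite !lact_id.
Qed.

(** The map to the product of the groups L x is the composite of the restriction
    to all orbits, with kernel as in [lf_orbit_kernel], and of a product of maps
    with locally finite kernels.  Indexing the product by letters instead of
    orbits only repeats factors. *)
Lemma lf_by_orbits (X : finType) (Y : set (aut X)) :
  (forall (I : finType) (G : I -> groupType), (forall i, P (G i)) -> P (dprodg G)) ->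
  gen_basilica Y -> (forall g, Y g -> exists a, directed_at g a) ->
  (forall x, lf_by P (gen (restrict (orb Y x) @` Y))) ->
  lf_by P (gen Y).
Proof.
move=> P_product YB Ydir IH.
pose O x := orb Y x.
have YO x : preserved (gen Y) (O x) by apply: orb_preserved.
pose K x : groupType := aut (alphabet (O x)).
pose L x : groupType := sval (cid (IH x)).
pose f x : K x -> L x := sval (cid (svalP (cid (IH x)))).
have fP x : [/\ {in gen (restrict (O x) @` Y) &, {morph f x : g h / g * h}},
    P (L x) & lf [set h | h \in gen (restrict (O x) @` Y) /\ f x h = 1]].
  exact: (svalP (cid (svalP (cid (IH x))))).
pose res (g : aut X) : dprodg K := fun x => restrict (O x) g.
have resY g x : g \in gen Y -> res g x \in gen (restrict (O x) @` Y).
  by move=> gY; have [] := restrict_gen YB (@YO x) gY.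
have resM : {in gen Y &, {morph res : g h / g * h}}.
  move=> g h gY hY; apply: functional_extensionality_dep => x.
  exact: restrict_morph YB (@YO x) _ _ gY hY.
exists (dprodg L), (fun g x => f x (res g x)); split.
- move=> g h gY hY; apply: functional_extensionality_dep => x.
  by have [fM _ _] := fP x; rewrite resM // fM ?resY.
- by apply: P_product => x; have [] := fP x.
pose M x := [set h : K x | h \in gen (restrict (O x) @` Y) /\ f x h = 1].
apply: (@lfS _ _ [set g | g \in gen Y /\ [set h : dprodg K | forall x, M x (h x)] (res g)]).
  move=> g [gY Fg]; split=> // x; split; first exact: resY.
  by have := congr1 (fun h : dprodg L => h x) Fg.
apply: lf_extension => //; last by apply: lf_dprod => x; have [] := fP x.
apply: lfS (lf_orbit_kernel Ydir) => k [kY rk]; split=> // x w wO.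
have rk1 : restrict (O x) k = 1 by have := congr1 (fun h : dprodg K => h x) rk.
have wE : map val (pmap insub w : seq (alphabet (O x))) = w.
  by elim: w wO => //= y w IHw /andP[yO /IHw wE]; rewrite insubT /= wE.
have [kr _] := restrict_gen YB (@YO x) kY.
by have := kr (pmap insub w); rewrite rk1 wE.
Qed.

End Reductions.

Theorem theorem7p7
  (Q : forall X : finType, set (aut X) -> Prop)
  (P : groupType -> Prop)
  (Q_stable : sub_basilica_stable Q)
  (P_isom : isom_invariant P)
  (P_abelian : forall G : groupType, abelian_group G -> P G)
  (P_subgroup : forall (G : groupType) (H : groupClosed G), P G -> P (subgrp H))
  (P_product : forall (I : finType) (G : I -> groupType),
     (forall i, P (G i)) -> P (dprodg G))
  (P_by_finite : forall G : groupType, group_by P finite_group G -> P G)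
  (P_self_replicating : forall (X : finType) (Y : set (aut X)),
     gen_basilica Y -> Q X Y -> self_replicating (gen Y) ->
     P (subgrp (gen Y))) :
  forall (X : finType) (Y : set (aut X)),
    gen_basilica Y -> Q X Y ->
    group_by locally_finite P (subgrp (gen Y)).
Proof.
move=> X Y YB QY; apply: lf_by_group_by => //.
have [n] := ubnP #|X|; elim: n X Y YB QY => // n IH X Y YB QY; rewrite ltnS => Xn.
(* From now on only the directed generators matter. *)
apply: (lf_by_letter_perm _ (gen_basilica_section YB)) => [L PL|].
  exact: wreath_property.
have dirY : directed Y `<=` Y by move=> g [].
have DB := gen_basilica_sub YB dirY.
have [QD QO] := Q_stable X Y YB QY _ dirY DB.
have Ddir g : directed Y g -> exists a, directed_at g a by case.
have [tr|ntr] := pselect (letter_transitive (gen (directed Y))).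
  apply: lf_by_of_property; apply: P_self_replicating => //.
  exact: directed_self_replicating.
apply: lf_by_orbits => // x.
have xO := @orb_preserved _ (directed Y) x.
apply: IH; [exact: gen_basilica_restrict|exact: QO|].
(* A single orbit of full size would make the action transitive. *)
apply: leq_trans Xn; rewrite card_sig ltnNge; apply/negP => Xle.
have orbT y : y \in orb (directed Y) x.
  have /eqP/setP/(_ y) : orb (directed Y) x == [set: X]%SET.
    by rewrite eqEcard finset.subsetT cardsT.
  by rewrite inE => ->.
apply: ntr => y z; have /orbP[g gD gx] := orbT y; have /orbP[h hD hx] := orbT z.
exists (h * g^-1); first by rewrite gpredM // gpredV.
by apply/lactP; rewrite lactM -gx lactK.
Qed.
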